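(* Let $\mathcal{A}$ be a minimally self-adjusting BST algorithm. Suppose there are a constant $C$ and a function $f:\mathbb{N}\to\mathbb{N}$ with $f(N)=N^{o(1)}$ (i.e. $\log f(N)/\log N\to0$) such that whenever $\mathcal{A}$ is executed on a BST $T$, every after-tree $A$ it creates satisfies: (i) the nodes of $A$ other than its root can be partitioned into at most $C$ monotone sets, and (ii) $A$ has at most $f(|T|)$ leaves. Then $\mathcal{A}$ does not satisfy the sequential access theorem.
   Context: A minimally self-adjusting BST algorithm, on access to $s$ in the current BST $T$ with search path $P$ (nodes on the root-to-$s$ path including $s$), replaces $P$ by a BST $A$ on node set $P$ with root $s$ (the after-tree), reattaching the subtrees hanging off $P$ in the unique order-consistent way; the cost of the access is $|P|$. A subset $X\subseteq P$ is monotone if either all its elements are larger than $s$ and have the same right-depth in $A$, or all are smaller than $s$ and have the same left-depth in $A$ (right-/left-depth: number of right-/left-going edges on the root-to-node path). An algorithm satisfies the sequential access theorem if there is a constant $K$ such that, starting from an arbitrary initial BST $T$, it accesses all elements of $T$ in increasing order with total cost at most $K|T|$. *)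

(* Defs.v *)
From mathcomp Require Import all_boot all_order all_algebra.
From mathcomp Require Import all_classical all_reals all_analysis.

Set Implicit Arguments.
Unset Strict Implicit.
Unset Printing Implicit Defensive.

Import Order.TTheory GRing.Theory Num.Theory.
Import numFieldNormedType.Exports.

Inductive btree : Type :=
  | Empty
  | Node of btree & nat & btree.

Fixpoint inorder (t : btree) : seq nat :=
  if t is Node l x r then inorder l ++ x :: inorder r else [::].

Definition num_nodes (t : btree) : nat := size (inorder t).

Definition bst (t : btree) : bool := sorted ltn (inorder t).

Definition has_root (t : btree) (s : nat) : bool :=
  if t is Node _ x _ then x == s else false.

(* A leaf is a node without children; [Empty] is not a node. *)
Fixpoint leaves (t : btree) : nat :=
  match t with
  | Empty => 0
  | Node Empty _ Empty => 1
  | Node l _ r => leaves l + leaves r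
  end.

Fixpoint search_path (t : btree) (s : nat) : seq nat :=
  if t is Node l x r then
    if s < x then x :: search_path l s
    else if x < s then x :: search_path r s
    else [:: x]
  else [::].

Fixpoint left_depth (t : btree) (x : nat) : nat :=
  if t is Node l y r then
    if x < y then (left_depth l x).+1
    else if y < x then left_depth r x
    else 0
  else 0.

Fixpoint right_depth (t : btree) (x : nat) : nat :=
  if t is Node l y r then
    if x < y then right_depth l x
    else if y < x then (right_depth r x).+1
    else 0
  else 0.

(* The subtrees hanging off the search path of [s], from left to right. Empty
   ones are included, so there is one more of them than nodes on the path. *)
Fixpoint hanging (t : btree) (s : nat) : seq btree :=
  if t is Node l x r then
    if s < x then rcons (hanging l s) r
    else if x < s then l :: hanging r s
    else [:: l; r]
  else [:: Empty].

(* Fills the [(num_nodes a).+1] empty positions of [a], from left to right, with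
   the trees in [hs]. *)
Fixpoint graft (a : btree) (hs : seq btree) : btree :=
  if a is Node l x r then
    Node (graft l (take (num_nodes l).+1 hs)) x (graft r (drop (num_nodes l).+1 hs))
  else head Empty hs.

(* [alg T h s] is the after-tree chosen on access to [s], when the initial tree
   is [T] and the earlier accesses are [h], MOST RECENT FIRST. These data
   determine the whole execution so far, so the choice may depend on the current
   tree and on any memory kept by the algorithm, but not on future accesses. *)
Definition algorithm : Type := btree -> seq nat -> nat -> btree.

Fixpoint current (alg : algorithm) (T : btree) (h : seq nat) : btree :=
  if h is s :: h' then graft (alg T h' s) (hanging (current alg T h') s)
  else T.

Fixpoint total_cost (alg : algorithm) (T : btree) (h : seq nat) : nat :=
  if h is s :: h' then
    total_cost alg T h' + size (search_path (current alg T h') s)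
  else 0.

(* [A] is the after-tree created by [alg] on access to [s], at some point of
   some execution from the initial tree [T]. *)
Definition creates (alg : algorithm) (T : btree) (h : seq nat) (s : nat)
    (A : btree) : Prop :=
  [/\ bst T, {subset s :: h <= inorder T} & A = alg T h s].

Definition minimally_self_adjusting (alg : algorithm) : Prop :=
  forall T h s A, creates alg T h s A ->
    [/\ bst A, inorder A =i search_path (current alg T h) s & has_root A s].

Definition monotone_set (A : btree) (s : nat) (X : seq nat) : Prop :=
  {subset X <= inorder A} /\
  (  {in X, forall x, s < x}
       /\ {in X &, forall x y, right_depth A x = right_depth A y}
   \/ {in X, forall x, x < s}
       /\ {in X &, forall x y, left_depth A x = left_depth A y}).

(* The [perm_eq] condition says that the members of [Xs] are pairwise disjoint
   and cover the non-root nodes, since [inorder A] has no repetition. *)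
Definition monotone_partition (A : btree) (s : nat) (Xs : seq (seq nat)) : Prop :=
  perm_eq (flatten Xs) [seq x <- inorder A | x != s]
  /\ {in Xs, forall X, monotone_set A s X}.

Definition sequential_access (alg : algorithm) : Prop :=
  exists K : nat, forall T, bst T ->
    total_cost alg T (rev (inorder T)) <= K * num_nodes T.

(* f(N) = N^o(1). *)
Definition subpolynomial (R : realType) (f : nat -> nat) : Prop :=
  ((fun N : nat => ln ((f N)%:R : R) / ln (N%:R : R)) @ \oo --> (0 : R))%R%classic.

(* Main.v *)
(** Access [0, ..., n-1] starting from the path in which every edge goes left. Call
two elements equivalent if they have the same largest ancestor below them. When [s]
is accessed, an element [x >= s] lies on the search path iff that ancestor is [< s],
so equivalent pending elements are touched together, and those left untouched remain
equivalent. A touched class is split according to the after-tree [A], in which the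
pending elements form at most [G = C * f n + 1] classes: their right-depth in [A] is
at most [C], and each right-depth level consists of at most [leaves A] left-going
chains. Since all elements start out equivalent and each must be touched when it is
accessed, at most [(G + 1) ^ L] of them are touched [L] times or fewer; this is
[o(n)] for every constant [L], so the total cost is superlinear. *)

From Pilot Require Import Defs.
From mathcomp Require Import all_boot all_order all_algebra.
From mathcomp Require Import all_classical all_reals all_analysis.
From mathcomp Require Import zify.
Import Order.TTheory GRing.Theory Num.Theory.
Import Pilot.Defs.

Set Implicit Arguments.
Unset Strict Implicit.
Unset Printing Implicit Defensive.

(** * Membership in search trees *)

Lemma bst_node l x r :
  bst (Node l x r) =
  [&& bst l, bst r, all (fun y => y < x) (inorder l)
    & all (fun y => x < y) (inorder r)].
Proof.
rewrite /bst !(sorted_pairwise ltn_trans) /= pairwise_cat pairwise_cons.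
rewrite allrel_consr; apply/idP/idP.
  by case/and3P=> /andP[-> _] -> /andP[-> ->].
case/and4P=> -> -> lx xr; rewrite lx xr !andbT; apply/allrelP => y z yl zr.
exact: ltn_trans (allP lx _ yl) (allP xr _ zr).
Qed.

Variant bst_node_spec l x r : Prop :=
  BstNodeSpec of bst l & bst r & {in inorder l, forall y, y < x}
    & {in inorder r, forall y, x < y}.

Lemma bst_nodeP l x r : bst (Node l x r) -> bst_node_spec l x r.
Proof. by rewrite bst_node => /and4P[? ? /allP ? /allP ?]; split. Qed.

Lemma mem_node l x r y :
  (y \in inorder (Node l x r)) = [|| y \in inorder l, y == x | y \in inorder r].
Proof. by rewrite /= mem_cat inE. Qed.

Lemma mem_node_lt l x r y : bst (Node l x r) -> y < x ->
  (y \in inorder (Node l x r)) = (y \in inorder l).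
Proof.
move=> /bst_nodeP[_ _ _ gtr] yx; rewrite mem_node (ltn_eqF yx) /=.
by case: (boolP (y \in inorder r)) => [/gtr|]; [lia | rewrite orbF].
Qed.

Lemma mem_node_gt l x r y : bst (Node l x r) -> x < y ->
  (y \in inorder (Node l x r)) = (y \in inorder r).
Proof.
move=> /bst_nodeP[_ _ ltl _] xy; rewrite mem_node (gtn_eqF xy) /=.
by case: (boolP (y \in inorder l)) => [/ltl|] //; lia.
Qed.

(** * Search paths and grafting *)

(** Keeping the shape that the path has in [t] makes this tree comparable with an after-tree: both
    have the path as node set. *)
Fixpoint path_tree (t : btree) (s : nat) : btree :=
  if t is Node l x r then
    if s < x then Node (path_tree l s) x Empty
    else if x < s then Node Empty x (path_tree r s)
    else Node Empty x Empty
  else Empty.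

Lemma inorder_path_tree t s : inorder (path_tree t s) =i search_path t s.
Proof.
elim: t => //= l IHl x r IHr y; case: ifP => _; last case: ifP => _ //=.
  by rewrite /= mem_cat IHl !inE orbC.
by rewrite !inE IHr.
Qed.

Lemma sub_path_tree t s : {subset inorder (path_tree t s) <= inorder t}.
Proof.
elim: t => //= l IHl x r IHr y.
case: ifP => _; last case: ifP => _; rewrite /= !(mem_cat, inE).
- by case/orP => [/IHl|/eqP] ->; rewrite ?eqxx ?orbT.
- by case/orP => [/eqP|/IHr] ->; rewrite ?eqxx ?orbT.
- by move/eqP ->; rewrite eqxx orbT.
Qed.

Lemma bst_path_tree t s : bst t -> bst (path_tree t s).
Proof.
elim: t => //= l IHl x r IHr /bst_nodeP[bl br ltl gtr].
case: ifP => _; last case: ifP => _ //; rewrite bst_node.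
- by rewrite IHl //= andbT; apply/allP => y /sub_path_tree /ltl.
- by rewrite IHr //=; apply/allP => y /sub_path_tree /gtr.
Qed.

Lemma mem_search_path_self t s : bst t ->
  s \in inorder t -> s \in search_path t s.
Proof.
elim: t => //= l IHl x r IHr b; have [bl br _ _] := bst_nodeP b.
case: ltngtP => sx; last by rewrite inE sx.
- by move/(etrans (esym (mem_node_lt b sx))) => /IHl; rewrite inE orbC => ->.
- by move/(etrans (esym (mem_node_gt b sx))) => /IHr; rewrite inE orbC => ->.
Qed.

Lemma size_hanging t s :
  size (hanging t s) = (num_nodes (path_tree t s)).+1.
Proof.
rewrite /num_nodes; elim: t => //= l IHl x r IHr.
case: ifP => _; last case: ifP => _ //=; last by rewrite IHr.
by rewrite size_rcons IHl size_cat addn1.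
Qed.

(* Hence a lemma about [graft a hs] compares the trees before and after an access. *)
Lemma graft_path_tree t s : graft (path_tree t s) (hanging t s) = t.
Proof.
elim: t => //= l IHl x r IHr.
case: ifP => _; last case: ifP => _ //=; last by rewrite drop0 IHr.
rewrite /= -cats1 take_size_cat ?drop_size_cat ?size_hanging //.
by rewrite IHl.
Qed.

(** All that [inorder (graft a hs)] retains of [a] is [inorder a], so replacing a path by an
    after-tree on the same keys preserves the order of the whole tree. *)
Fixpoint weave (xs : seq nat) (hs : seq btree) : seq nat :=
  inorder (head Empty hs) ++
  if xs is x :: xs' then x :: weave xs' (behead hs) else [::].

Lemma weave_cat xs x ys hs :
  weave (xs ++ x :: ys) hs =
  weave xs (take (size xs).+1 hs) ++ x :: weave ys (drop (size xs).+1 hs).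
Proof.
elim: xs hs => [|z xs IH] hs; last first.
  by case: hs => [|h hs] /=; rewrite IH -?catA.
by case: hs => [|h hs] /=; rewrite ?take0 ?drop0 ?cats0.
Qed.

Lemma inorder_graft a hs : inorder (graft a hs) = weave (inorder a) hs.
Proof.
elim: a hs => [|l IHl x r IHr] hs /=; first by rewrite cats0.
by rewrite weave_cat IHl IHr.
Qed.

(** * Lower ancestors and touched elements *)

(* One more than the largest ancestor of [x] below [x], and [0] if there is none. *)
Fixpoint lower_ancestor (t : btree) (x : nat) : nat :=
  if t is Node l y r then
    if x < y then lower_ancestor l x
    else if y < x then maxn y.+1 (lower_ancestor r x)
    else 0
  else 0.

(** The search for [s] follows the one for [x] until [x] is reached, unless some ancestor [y] of [x]
    has [s <= y < x]. The shift in [lower_ancestor] turns [y < s] into [<= s] and frees [0] for the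
    case of no lower ancestor. *)
Lemma mem_search_path t s x : bst t -> x \in inorder t -> s <= x ->
  (x \in search_path t s) = (lower_ancestor t x <= s).
Proof.
elim: t => // l IHl y r IHr b xt sx; have [bl br ltl gtr] := bst_nodeP b.
have nml z : y <= z -> z \in search_path l s = false.
  move=> yz; apply/negbTE; rewrite -inorder_path_tree.
  by apply/negP => /sub_path_tree/ltl; lia.
have nmr z : z <= y -> z \in search_path r s = false.
  move=> yz; apply/negbTE; rewrite -inorder_path_tree.
  by apply/negP => /sub_path_tree/gtr; lia.
rewrite /=; case: (ltngtP x y) xt => xy xt.
- rewrite (leq_ltn_trans sx xy) inE (ltn_eqF xy) IHl //.
  by rewrite -(mem_node_lt b).
- rewrite geq_max.
  case: ltngtP => sy; rewrite inE (gtn_eqF xy) ?nml ?(ltnW xy) //=.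
  by rewrite IHr // -(mem_node_gt b).
- by case: ltngtP sx => // ? _; rewrite xy in_cons eqxx.
Qed.

Lemma lower_ancestor_graft_in a hs x : bst a -> x \in inorder a ->
  lower_ancestor (graft a hs) x = lower_ancestor a x.
Proof.
elim: a hs => // l IHl y r IHr hs b xt /=; have [bl br ltl gtr] := bst_nodeP b.
case: (ltngtP x y) xt => xy // xt.
- by rewrite IHl // -(mem_node_lt b).
- by rewrite IHr // -(mem_node_gt b).
Qed.

(** The position receiving [x] lies below the predecessor of [x] in [inorder a], if there is one, so
    the maximum over all smaller keys is attained at an ancestor. The value thus depends on [a] only
    through [inorder a]. *)
Lemma lower_ancestor_graft_out a hs x : bst a -> x \notin inorder a ->
  lower_ancestor (graft a hs) x =
  maxn (\max_(y <- inorder a | y < x) y.+1)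
       (lower_ancestor (nth Empty hs (count (fun z => z < x) (inorder a))) x).
Proof.
elim: a hs => [|l IHl y r IHr] hs b xt.
  by rewrite /= big_nil max0n -nth0.
have [bl br ltl gtr] := bst_nodeP b.
case: (ltngtP x y) (xt) => xy xt'; last by move: xt'; rewrite mem_node xy eqxx orbT.
- rewrite /= xy IHl //; last by rewrite -(mem_node_lt b xy).
  have cr : count (fun z => z < x) (inorder r) = 0.
    by apply/eqP; rewrite eqn0Ngt -has_count; apply/hasPn => z /gtr /=; lia.
  have mr : \max_(z <- inorder r | z < x) z.+1 = 0.
    rewrite big_seq_cond big1 // => z /andP[/gtr]; lia.
  rewrite big_cat big_cons /= ltnNge (ltnW xy) /= mr maxn0.
  rewrite count_cat /= cr ltnNge (ltnW xy) /= !addn0 nth_take //.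
  by rewrite ltnS /num_nodes count_size.
- rewrite /= xy ltnNge (ltnW xy) /= IHr //; last by rewrite -(mem_node_gt b xy).
  have cl : count (fun z => z < x) (inorder l) = num_nodes l.
    by apply/eqP; rewrite -all_count; apply/allP => z /ltl /=; lia.
  have ml : \max_(z <- inorder l | z < x) z.+1 <= y.
    by apply/bigmax_leqP_seq => z /ltl.
  rewrite big_cat big_cons /= xy count_cat /= xy cl nth_drop addSn add1n addnS.
  lia.
Qed.

(** * Counting lower ancestors in an after-tree *)

(* The nodes with a right child, shifted by one like [lower_ancestor]; on a search
   tree the [maxn] has no effect, and mirrors the one in [lower_ancestor]. *)
Fixpoint right_parents (t : btree) : seq nat :=
  if t is Node l y r then
    right_parents l ++
    if r is Empty then [::] else y.+1 :: map (maxn y.+1) (right_parents r)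
  else [::].

(** The largest ancestor of [x] below [x] has [x] in its right subtree, hence has a right child. *)
Lemma lower_ancestor_right_parents t x : bst t -> x \in inorder t ->
  lower_ancestor t x \in 0 :: right_parents t.
Proof.
elim: t => // l IHl y r IHr b xt /=; have [bl br ltl gtr] := bst_nodeP b.
rewrite inE mem_cat; case: (ltngtP x y) xt => xy // xt.
- have := IHl bl; rewrite -(mem_node_lt b xy) inE => /(_ xt) /orP[] -> //.
  by rewrite orbT.
- rewrite (mem_node_gt b xy) in xt; move: (IHr br xt).
  case: r {b IHr br gtr} xt => // r1 z r2 _.
  set r := Node r1 z r2; rewrite [in X in _ -> X]inE !inE => /orP[/eqP->|H].
    by rewrite maxn0 eqxx !orbT.
  by rewrite map_f ?orbT.
Qed.

Lemma leaves_gt0 t : t <> Empty -> 0 < leaves t.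
Proof.
elim: t => // l IHl x r IHr _; case: l IHl => [_|l1 y l2 IHl]; last first.
  by rewrite -[leaves _]/(leaves (Node l1 y l2) + leaves r) addn_gt0 IHl.
by case: r IHr => // r1 y r2 IHr; apply: IHr.
Qed.

Lemma leaves_node_ge l x r : leaves l + leaves r <= leaves (Node l x r).
Proof. by case: l => // *; case: r. Qed.

Lemma right_depth_node_lt l x r y : y < x ->
  right_depth (Node l x r) y = right_depth l y.
Proof. by rewrite /= => ->. Qed.

Lemma right_depth_node_gt l x r y : x < y ->
  right_depth (Node l x r) y = (right_depth r y).+1.
Proof. by move=> xy; rewrite /= xy ltnNge ltnW. Qed.

(** Along the path from the root to [x], right-depth starts at 0 and grows by at most one per
    edge. *)
Lemma right_depth_interval t x d : bst t -> x \in inorder t ->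
  d <= right_depth t x -> exists2 y, y \in inorder t & right_depth t y = d.
Proof.
elim: t d => // l IHl z r IHr d b xt; have [bl br ltl gtr] := bst_nodeP b.
case: (ltngtP x z) (xt) => xz xt'.
- rewrite (mem_node_lt b xz) in xt'; rewrite right_depth_node_lt //.
  move=> /(IHl _ bl xt')[y yl <-]; exists y; first by rewrite mem_node yl.
  by rewrite right_depth_node_lt // ltl.
- rewrite (mem_node_gt b xz) in xt'; rewrite right_depth_node_gt //.
  case: d => [_|d /(IHr _ br xt')[y yr <-]].
    by exists z; rewrite ?mem_node ?eqxx ?orbT //= ltnn.
  exists y; first by rewrite mem_node yr !orbT.
  by rewrite right_depth_node_gt // gtr.
- rewrite {1}xz /= ltnn leqn0 => /eqP ->.
  by exists z; rewrite ?mem_node ?eqxx ?orbT //= ltnn.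
Qed.

(** Charge a node to a leaf of its right subtree; a leaf is charged at most [D] times. In the
    induction, the right subtree satisfies the bound for [D - 1], and its leaves, at least one, pay
    for the root. *)
Lemma size_right_parents t D : bst t ->
  {in inorder t, forall x, right_depth t x <= D} ->
  size (right_parents t) <= D * leaves t.
Proof.
elim: t D => // l IHl y r IHr D b rd; have [bl br ltl gtr] := bst_nodeP b.
have rdl : {in inorder l, forall x, right_depth l x <= D}.
  move=> x xl; have := rd x; rewrite mem_node xl right_depth_node_lt ?ltl //.
  exact.
have rdr : {in inorder r, forall x, right_depth r x < D}.
  move=> x xr; have := rd x; rewrite mem_node xr right_depth_node_gt ?gtr //.
  by rewrite !orbT; apply.
apply: leq_trans (leq_mul (leqnn D) (leaves_node_ge l y r)).
rewrite mulnDr /= size_cat leq_add ?IHl //.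
case: r {b br gtr rd} IHr br rdr => // r1 z r2; set r := Node r1 z r2.
move=> IHr br rdr; have l0 : 0 < leaves r by apply: leaves_gt0.
move: (right_parents r) (leaves r) l0 IHr => rp lv l0 IHr /=; rewrite size_map.
case: D rdr {rdl} => [/(_ z)|D rdr].
  by rewrite mem_node eqxx orbT => /(_ isT).
by have := IHr D br rdr; rewrite mulSn; lia.
Qed.

Lemma size_undup_map_flatten (T : eqType) (f : T -> nat) (Xs : seq (seq T)) :
  {in Xs, forall X, {in X &, forall x y, f x = f y}} ->
  size (undup (map f (flatten Xs))) <= size Xs.
Proof.
elim: Xs => //= X Xs IH fX; rewrite map_cat undup_cat size_cat addnC -addn1.
apply: leq_add; first by apply: IH => Y YXs; apply: fX; rewrite inE YXs orbT.
rewrite size_filter (leq_trans (count_size _ _)) //.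
have {}fX := fX X (mem_head _ _).
case: X fX => // x X fX; rewrite -[1]/(size [:: f x]) uniq_leq_size ?undup_uniq //.
move=> _ /[!mem_undup] /mapP[y yX ->]; rewrite inE (fX y x) ?mem_head //.
Qed.

(** The path to [x] meets every right-depth from 1 to that of [x] at nodes larger than [s], and a
    monotone set of larger nodes accounts for only one of these depths. *)
Lemma right_depth_monotone_partition A s Xs : bst A -> has_root A s ->
  monotone_partition A s Xs ->
  {in inorder A, forall x, s < x -> right_depth A x <= size Xs}.
Proof.
case: A => // L s' R b /eqP s's; rewrite {s'}s's in b *.
set A := Node L s R => -[perm mono] x xA sx.
have [bL bR ltL gtR] := bst_nodeP b.
(* Keeping only keys above [s] empties the sets of smaller keys, so right-depth is constant on each
   list. *)
pose Ys := [seq [seq y <- X | s < y] | X <- Xs].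
suff: size (iota 1 (right_depth A x)) <=
      size (undup (map (right_depth A) (flatten Ys))).
  rewrite size_iota => /leq_trans-> //.
  rewrite -(size_map (fun X => [seq y <- X | s < y])) size_undup_map_flatten //.
  move=> _ /mapP[X XXs ->] y z; rewrite !mem_filter => /andP[sy yX] /andP[sz zX].
  case: (mono X XXs) => _ [[_ eqX]|[/(_ _ yX)]]; [exact: eqX|lia].
apply: uniq_leq_size (iota_uniq _ _) _ => d; rewrite mem_iota => /andP[d0 dx].
rewrite mem_undup; have xR : x \in inorder R by rewrite -(mem_node_gt b).
rewrite right_depth_node_gt // in dx.
have [y yR dy] : exists2 y, y \in inorder R & right_depth R y = d.-1.
  by apply: right_depth_interval xR _; lia.
have sy := gtR y yR; apply/mapP; exists y; last first.
  by rewrite right_depth_node_gt // dy; lia.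
rewrite -filter_flatten mem_filter sy /= (perm_mem perm) mem_filter.
by rewrite gtn_eqF // mem_node yR !orbT.
Qed.

Lemma few_lower_ancestors A s C : bst A -> has_root A s ->
  (exists2 Xs, size Xs <= C & monotone_partition A s Xs) ->
  exists2 V : seq nat, size V <= (C * leaves A).+1 &
    {in inorder A, forall x, s < x -> lower_ancestor A x \in V}.
Proof.
case: A => // L s' R b /eqP s's; rewrite {s'}s's in b * => -[Xs XsC mXs].
have [bL bR ltL gtR] := bst_nodeP b.
(* A key above [s] lies in [R]; if it has no lower ancestor there, its value [0] becomes [s.+1],
   whence the extra one in the bound. *)
exists (map (maxn s.+1) (0 :: right_parents R)).
  rewrite size_map ltnS; apply: leq_trans (_ : C * leaves R <= _).
    apply: size_right_parents => // x xR; apply: leq_trans XsC.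
    have := right_depth_monotone_partition b (eqxx s) mXs (x := x).
    rewrite mem_node xR !orbT right_depth_node_gt ?gtR // => /(_ isT isT).
    exact: ltnW.
  rewrite leq_mul //; apply: leq_trans (leaves_node_ge L s R); exact: leq_addl.
move=> x xA sx; rewrite /= sx ltnNge ltnW //= -map_cons map_f //.
by rewrite lower_ancestor_right_parents // -(mem_node_gt b).
Qed.

(** * Counting rarely touched elements *)

(* An element touched now is distinguished from the others touched now by one of
   [G] values, so those touched at most [L] times number at most [(G + 1) ^ L]. *)
Lemma card_rarely_touched (p : nat -> nat -> nat) (n G : nat)
    (p_diag : forall t, t < n -> p t t <= t)
    (p_stay : forall t x, t < x < n -> t < p t x -> p t.+1 x = p t x)
    (p_few : forall t, t < n -> exists2 V : seq nat, size V <= G &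
       forall x, t < x < n -> p t x <= t -> p t.+1 x \in V)
    (k t L v : nat) (S : seq nat) :
  k + t = n -> uniq S -> {in S, forall x, t <= x < n} ->
  {in S, forall x, p t x = v} ->
  {in S, forall x, count (fun u => (u <= x) && (p u x <= u)) (iota t k) <= L} ->
  size S <= G.+1 ^ L.
Proof.
(* Induction on the number [k] of remaining accesses: [S] lies in one class at time [t], and [L] is
   the number of touches still allowed. *)
elim: k t L v S => [|k IH] t L v S.
  rewrite add0n => -> _; case: S => // x S H.
  by have := H x (mem_head _ _); lia.
move=> ktn uS tS pS cS; have tn : t < n by lia.
have kt : k + t.+1 = n by lia.
(* An untouched class cannot contain [t], which is touched at its own access, so it stays
   together. *)
have [vt|tv] := leqP v t; last first.
  have tS' : {in S, forall x, t < x < n}.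
    move=> x xS; have := tS x xS; have [xt|] := eqVneq x t; last lia.
    by have := pS x xS; rewrite xt; have := p_diag t tn; lia.
  apply: (IH t.+1 L v) => // x xS; last first.
    by have /= := cS x xS; apply: leq_trans; exact: leq_addl.
  by rewrite p_stay ?tS' // pS.
case: L cS => [|L] cS.
  case: S uS tS pS cS => // x S _ tS pS cS.
  have [tx _] := andP (tS x (mem_head _ _)).
  by have /= := cS x (mem_head _ _); rewrite pS ?mem_head // vt tx.
have [V VG pV] := p_few t tn.
(* The key [t] is set aside because [p_few] controls only larger keys; it is the 1 in
   [1 + G * G.+1 ^ L <= G.+1 ^ L.+1]. *)
pose S' := [seq x <- S | x != t].
have S'P x : x \in S' -> x \in S /\ t < x < n.
  by rewrite mem_filter => /andP[xt xS]; have := tS x xS; split=> //; lia.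
have SS' : size S <= (size S').+1.
  rewrite size_filter -(count_predC (pred1 t) S) -add1n leq_add2r.
  by rewrite count_uniq_mem // leq_b1.
have S'V : size S' <= size (flatten [seq [seq x <- S' | p t.+1 x == w] | w <- V]).
  apply: uniq_leq_size; first exact: filter_uniq.
  move=> x xS'; have [xS xt] := S'P x xS'.
  apply/flattenP; exists [seq y <- S' | p t.+1 y == p t.+1 x].
    by apply/mapP; exists (p t.+1 x) => //; rewrite pV // pS.
  by rewrite mem_filter eqxx.
have piece w : size [seq x <- S' | p t.+1 x == w] <= G.+1 ^ L.
  apply: (IH t.+1 L w) => //; first by rewrite !filter_uniq.
  - by move=> x; rewrite mem_filter => /andP[_ /S'P[]].
  - by move=> x; rewrite mem_filter => /andP[/eqP].
  - move=> x; rewrite mem_filter => /andP[_ /S'P[xS /andP[tx _]]].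
    by have /= := cS x xS; rewrite pS // vt (ltnW tx).
have {}S'V : size S' <= size V * G.+1 ^ L.
  apply: leq_trans S'V _; elim: V {VG pV} => //= w V IHV.
  by rewrite size_cat mulSn leq_add.
have := leq_mul VG (leqnn (G.+1 ^ L)); have : 0 < G.+1 ^ L by rewrite expn_gt0.
by rewrite expnS mulSn; lia.
Qed.

(** Markov's inequality. *)
Lemma leq_mul_count_sum (c : nat -> nat) (L : nat) (s : seq nat) :
  L.+1 * count (fun x => L < c x) s <= \sum_(x <- s) c x.
Proof.
elim: s => [|x s IH]; first by rewrite muln0.
by rewrite big_cons /= mulnDr leq_add //; case: ltnP; rewrite ?muln1 ?muln0.
Qed.

(** * Executions of the algorithm *)

Section Execution.

Context (alg : algorithm) (alg_msa : minimally_self_adjusting alg).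

Lemma inorder_after_tree t s A : bst t -> bst A ->
  inorder A =i search_path t s -> inorder A = inorder (path_tree t s).
Proof.
move=> bt bA eqA; apply: (irr_sorted_eq ltn_trans ltnn) => //.
  exact: bst_path_tree.
by move=> x; rewrite eqA inorder_path_tree.
Qed.

Lemma inorder_current T h : bst T -> {subset h <= inorder T} ->
  inorder (current alg T h) = inorder T.
Proof.
move=> bT; elim: h => //= s h IH sub.
have {}IH : inorder (current alg T h) = inorder T.
  by apply: IH => x xh; apply: sub; rewrite inE xh orbT.
have bt : bst (current alg T h) by rewrite /bst IH.
have [bA eqA _] := alg_msa (And3 bT sub erefl).
rewrite inorder_graft (inorder_after_tree bt bA eqA) -inorder_graft.
by rewrite graft_path_tree.
Qed.

Lemma bst_current T h : bst T -> {subset h <= inorder T} ->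
  bst (current alg T h).
Proof. by move=> bT sub; rewrite /bst inorder_current. Qed.

(** The trees before and after the access are grafts of the same hanging subtrees onto trees with
    the same inorder sequence, which is all that [lower_ancestor_graft_out] depends on. *)
Lemma lower_ancestor_untouched T h s x : bst T ->
  {subset s :: h <= inorder T} -> x \notin search_path (current alg T h) s ->
  lower_ancestor (current alg T (s :: h)) x =
  lower_ancestor (current alg T h) x.
Proof.
move=> bT sub xP; have [bA eqA _] := alg_msa (And3 bT sub erefl).
have bt : bst (current alg T h).
  by apply: bst_current => // y yh; apply: sub; rewrite inE yh orbT.
rewrite -[in RHS](graft_path_tree (current alg T h) s) /=.
rewrite !lower_ancestor_graft_out ?inorder_path_tree ?eqA //.
  by rewrite (inorder_after_tree bt bA eqA).
exact: bst_path_tree.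
Qed.

End Execution.

(** * The initial tree and asymptotics *)

Fixpoint left_path (n : nat) : btree :=
  if n is m.+1 then Node (left_path m) m Empty else Empty.

Lemma inorder_left_path n : inorder (left_path n) = iota 0 n.
Proof. by elim: n => // n IH; rewrite -[in RHS]addn1 iotaD /= IH. Qed.

Lemma bst_left_path n : bst (left_path n).
Proof. by rewrite /bst inorder_left_path iota_ltn_sorted. Qed.

(** All proper ancestors are larger, so all keys start in one class. *)
Lemma lower_ancestor_left_path n x : x < n ->
  lower_ancestor (left_path n) x = 0.
Proof.
by elim: n => //= n IH; rewrite ltnS; case: ltngtP => // xn _; exact: IH.
Qed.

Lemma rev_iotaS n : rev (iota 0 n.+1) = n :: rev (iota 0 n).
Proof. by rewrite -addn1 iotaD rev_cat. Qed.

Lemma total_cost_rev_iota alg T n : total_cost alg T (rev (iota 0 n)) =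
  \sum_(t <- iota 0 n)
    size (search_path (current alg T (rev (iota 0 t))) t).
Proof.
elim: n => [|n IH]; first by rewrite big_nil.
by rewrite rev_iotaS -[in RHS]addn1 iotaD big_cat big_seq1 /= IH.
Qed.

(** Eventually [ln (f n) / ln n < 1 / (k + 1)], hence [f n ^ k <= n]. The [maxn] keeps the base
    positive where [f n = 0]. *)
Lemma subpolynomial_expn (R : realType) (f : nat -> nat) (k : nat) :
  subpolynomial R f -> exists n0, forall n, n0 <= n -> maxn (f n) 1 ^ k <= n.
Proof.
move=> /cvgrPdist_lt /(_ (k.+1%:R^-1)%R); rewrite invr_gt0 ltr0n => /(_ isT).
(* The threshold 2 makes [ln n] positive. *)
case=> n0 _ H; exists (maxn n0 2) => n; rewrite geq_max => /andP[n0n n2].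
have [f0|f0] := posnP (f n); first by rewrite f0 exp1n ltnW.
rewrite (maxn_idPl f0).
have ln_n : (0 < ln (n%:R : R))%R by rewrite ln_gt0 // ltr1n.
have ln_f : (0 <= ln ((f n)%:R : R))%R by rewrite ln_ge0 // ler1n.
have /= := H n n0n; rewrite sub0r normrN ger0_norm; last first.
  by rewrite divr_ge0 // ltW.
rewrite ltr_pdivrMr // ltr_pdivlMl ?ltr0n // => lt.
rewrite -(ler_nat R) natrX -ler_ln ?posrE ?exprn_gt0 ?ltr0n //; last lia.
rewrite lnXn ?ltr0n // -[leLHS]mulr_natl; apply: le_trans (ltW lt).
by rewrite ler_wpM2r // ler_nat.
Qed.

Theorem theorem12 (R : realType) (alg : algorithm) (C : nat) (f : nat -> nat)
  (alg_msa : minimally_self_adjusting alg)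
  (f_subpoly : subpolynomial R f)
  (few_monotone_sets : forall (T : btree) (h : seq nat) (s : nat) (A : btree),
     creates alg T h s A ->
     exists2 Xs : seq (seq nat), size Xs <= C & monotone_partition A s Xs)
  (few_leaves : forall (T : btree) (h : seq nat) (s : nat) (A : btree),
     creates alg T h s A -> leaves A <= f (num_nodes T)) :
  ~ sequential_access alg.
Proof.
case=> K costK.
(* At least half of the keys will be touched more than [L] times, so [L.+1 = 2 * K.+1] forces a cost
   of at least [K.+1 * n]. The exponent is [2 * L] because [2 * B <= n] is proved by squaring. *)
have [n0 fn0] := subpolynomial_expn (2 * (2 * K).+1) f_subpoly.
pose L := (2 * K).+1; pose n := maxn (maxn n0 1) (4 * C.+2 ^ (2 * L)).
have n_gt0 : 0 < n by rewrite /n; lia.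
pose T := left_path n; pose G := (C * f n).+1.
have nT : num_nodes T = n by rewrite /num_nodes inorder_left_path size_iota.
have bT : bst T := bst_left_path n.
have memT x : (x \in inorder T) = (x < n).
  by rewrite inorder_left_path mem_iota.
pose h t := rev (iota 0 t); pose p t := lower_ancestor (current alg T (h t)).
have sub_h t : t <= n -> {subset h t <= inorder T}.
  by move=> tn x; rewrite mem_rev mem_iota memT => xt; lia.
have sub_hS t : t < n -> {subset t :: h t <= inorder T}.
  by rewrite -[t :: h t]rev_iotaS => /sub_h.
have touchedE t x : t < n -> t <= x < n ->
    (x \in search_path (current alg T (h t)) t) = (p t x <= t).
  move=> tn /andP[tx xn]; have sub := sub_h t (ltnW tn).
  by rewrite mem_search_path ?bst_current ?inorder_current ?memT.
pose B := G.+1 ^ L.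
have sparse S : uniq S -> {in S, forall x, x < n} ->
    {in S, forall x,
      count (fun u => (u <= x) && (p u x <= u)) (iota 0 n) <= L} ->
    size S <= B.
  move=> uS Sn; apply: (@card_rarely_touched p n G _ _ _ n 0 L 0) => //.
  - move=> t tn; rewrite -touchedE ?leqnn // mem_search_path_self //.
      by apply: bst_current => //; apply/sub_h/ltnW.
    by rewrite inorder_current ?memT //; apply/sub_h/ltnW.
  - move=> t x /andP[tx xn] tp; rewrite /p /h rev_iotaS.
    have tn := ltn_trans tx xn.
    apply: lower_ancestor_untouched => //; first exact: sub_hS.
    by rewrite touchedE // ?(ltnW tx) // -ltnNge.
  - move=> t tn; have crA := And3 bT (sub_hS t tn) (erefl (alg T (h t) t)).
    have [bA eqA rA] := alg_msa _ _ _ _ crA.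
    have [V VG pV] := few_lower_ancestors bA rA (few_monotone_sets _ _ _ _ crA).
    exists V.
      apply: leq_trans VG _; rewrite ltnS leq_mul2l -nT (few_leaves _ _ _ _ crA).
      exact: orbT.
    move=> x /andP[tx xn] ptx.
    (* A touched key is a node of the after-tree, so its new lower ancestor can be read off
       there. *)
    have xA : x \in inorder (alg T (h t) t) by rewrite eqA touchedE ?(ltnW tx).
    by rewrite /p /h rev_iotaS /= lower_ancestor_graft_in // pV.
  - exact: addn0.
  - by move=> x /Sn; exact: lower_ancestor_left_path.
pose c x := count (fun u => (u <= x) && (p u x <= u)) (iota 0 n).
(* Double counting of pairs of an access [t] and a key [x >= t] on its search path; smaller keys on
   the path are dropped. *)
have cost_ge : \sum_(x <- iota 0 n) c x <= total_cost alg T (h n).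
  rewrite total_cost_rev_iota /c.
  under eq_bigr do rewrite -sum1_count big_mkcond.
  rewrite exchange_big /= big_seq [leqRHS]big_seq leq_sum // => t.
  rewrite mem_iota => /= tn; rewrite -big_mkcond /= sum1_count -size_filter.
  rewrite uniq_leq_size ?filter_uniq ?iota_uniq // => x.
  rewrite mem_filter mem_iota => /andP[/andP[tx ptx] xn].
  by rewrite touchedE // tx.
have rareB : count (fun x => c x <= L) (iota 0 n) <= B.
  rewrite -size_filter; apply: sparse; first by rewrite filter_uniq ?iota_uniq.
    by move=> x; rewrite mem_filter mem_iota => /andP[].
  by move=> x; rewrite mem_filter => /andP[].
have B_small : 2 * B <= n.
  (* After squaring, one factor [n] absorbs the constant [4 * C.+2 ^ (2 * L)] and the other absorbs
     [m ^ (2 * L)]. *)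
  rewrite -leq_sqr expnMn /B -expnM; pose m := maxn (f n) 1.
  have Gm : G.+1 <= C.+2 * m by rewrite /G /m mulSn mulSn; nia.
  apply: leq_trans (_ : 2 ^ 2 * (C.+2 * m) ^ (L * 2) <= _).
    by rewrite leq_mul2l leq_exp2r ?Gm ?orbT // muln_gt0.
  rewrite expnMn mulnA [L * 2]mulnC leq_mul //; first by rewrite /n leq_maxr.
  by apply: fn0; rewrite /n; lia.
have half : n <= 2 * count (fun x => L < c x) (iota 0 n).
  have := count_predC (fun x => c x <= L) (iota 0 n); rewrite size_iota.
  by under [X in _ + X = _]eq_count do rewrite /= -ltnNge; lia.
have := costK T bT; rewrite inorder_left_path -/(h n) nT.
have := leq_trans (leq_mul_count_sum c L (iota 0 n)) cost_ge.
by have := leq_mul (leqnn K.+1) half; rewrite /L; lia.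
Qed.
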